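(* Let $\mathcal{A}_K(X)$ be the finite frozen class of arms, let $J_g(a;X)$ be the counterfactual memory regret of arm $a$, and let $V_{g,K}(X)=\max_{a\in\mathcal{A}_K(X)}J_g(a;X)$. Let $\eta\ge 0$, and for every $a\in\mathcal{A}_K(X)$ and every time $t$ let $\mathrm{LCB}_t(a)$ and $\mathrm{UCB}_t(a)$ be lower and upper confidence bounds for $J_g(a;X)$. Consider the simultaneous confidence event $$\mathcal{E}=\bigl\{\forall a\in\mathcal{A}_K(X),\ \forall t:\ \mathrm{LCB}_t(a)\le J_g(a;X)\le \mathrm{UCB}_t(a)\bigr\}.$$ Then, on the event $\mathcal{E}$, for every time $t$, any reported arm $\widehat a_t\in\mathcal{A}_K(X)$ satisfying $$\max_{a\in\mathcal{A}_K(X)}\mathrm{UCB}_t(a)-\mathrm{LCB}_t(\widehat a_t)\le\eta$$ obeys $$J_g(\widehat a_t;X)\ \ge\ V_{g,K}(X)-\eta .$$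
   Context: A memory mechanism $g$ has a set of persistent states, an initial state $S_0$, and an update map $U_g$ sending a state and a write to a new state. For a clean write $X$ and another write $x$, put $S_g^0=U_g(S_0,X)$ and $S_g^{x}=U_g(S_0,x)$. For a downstream task $q$ and rollout randomness $\omega$, $L_g(S;q,\omega)\in[0,1]$ is a bounded operational loss. The counterfactual memory regret (CMR) of a write $x$ is $$J_g(x;X)=\mathbb{E}\bigl[L_g(S_g^{x};Q,\omega^{\mathrm{edit}})-L_g(S_g^0;Q,\omega^{\mathrm{clean}})\bigr],$$ where $Q$ is drawn from a fixed task distribution and $(\omega^{\mathrm{edit}},\omega^{\mathrm{clean}})$ from a prespecified joint law with the correct rollout-randomness marginals. An arm is a pair $a=(e,x)$ of an edit program $e$ and a concrete write $x$ realizing it, and $J_g(a;X):=J_g(x;X)$. The class $\mathcal{A}_K(X)$ is a finite set of arms, fixed before any loss is observed, containing the zero-edit arm $a_0=(\varnothing,X)$; $K$ is the maximum number of edited factors. The confidence bounds $\mathrm{LCB}_t(a),\mathrm{UCB}_t(a)$ are random real numbers computed from the observations up to time $t$ of an adaptive sampling procedure, and the reported arm $\widehat a_t$ is chosen at time $t$ (it may be data-dependent). The intervals are constructed so that $\mathcal{E}$ has probability at least $1-\delta$ for a prescribed $\delta\in(0,1)$. *)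

(* Defs.v *)
From HB Require Import structures.
From mathcomp Require Import all_boot all_order all_algebra finmap.
From mathcomp Require Import all_classical all_reals all_analysis.

Set Implicit Arguments.
Unset Strict Implicit.
Unset Printing Implicit Defensive.
Import Order.TTheory GRing.Theory Num.Theory.
Local Open Scope classical_set_scope.
Local Open Scope ring_scope.

Record memory_mechanism (State Write : Type) := MemoryMechanism {
  init_state : State;
  update : State -> Write -> State }.

Definition state_after (State Write : Type)
    (g : memory_mechanism State Write) (x : Write) : State :=
  update g (init_state g) x.

Record operational_loss (R : realType) (State : Type)
    (dQ dW : measure_display) (Task : measurableType dQ)
    (Rollout : measurableType dW) := OperationalLoss {
  loss :> State -> Task -> Rollout -> R;
  loss_itv : forall S q w, 0 <= loss S q w <= 1;
  measurable_loss : forall S,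
    measurable_fun [set: Task * Rollout] (fun z => loss S z.1 z.2) }.

(* [run_law] is the law of (Q, omega) in a single rollout, so the rollout
   randomness may depend on the task; independence is the case
   run_law = task_law \x rho.  [coupled_law] is the law of
   (Q, (omega^edit, omega^clean)): the two rollouts share the task, and each
   of them separately has the law of a single rollout. *)
Record evaluation_protocol (R : realType) (dQ dW : measure_display)
    (Task : measurableType dQ) (Rollout : measurableType dW) :=
  EvaluationProtocol {
  task_law : probability Task R;
  run_law : probability (Task * Rollout)%type R;
  coupled_law : probability (Task * (Rollout * Rollout))%type R;
  run_law_task : forall B, measurable B ->
    pushforward run_law fst B = task_law B;
  coupled_law_edit : forall B, measurable B ->
    pushforward coupled_law (fun z => (z.1, z.2.1)) B = run_law B;
  coupled_law_clean : forall B, measurable B ->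
    pushforward coupled_law (fun z => (z.1, z.2.2)) B = run_law B }.

(* The expectation is finite because losses are measurable and lie in [0, 1];
   [fine] only casts it to R. *)
Definition cmr (R : realType) (State Write : Type) (dQ dW : measure_display)
    (Task : measurableType dQ) (Rollout : measurableType dW)
    (g : memory_mechanism State Write)
    (L : operational_loss R State Task Rollout)
    (D : evaluation_protocol R Task Rollout) (x X : Write) : R :=
  fine ('E_(coupled_law D)
    [(fun z => L (state_after g x) z.1 z.2.1
             - L (state_after g X) z.1 z.2.2)%R])%E.

(* [realizes X e x]: the concrete write x realizes the edit program e applied
   to the clean write X. *)
Record edit_language (Edit Write : Type) := EditLanguage {
  zero_edit : Edit;
  edited_factors : Edit -> nat;
  realizes : Write -> Edit -> Write -> Prop;
  edited_factors0 : edited_factors zero_edit = 0%N;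
  realizes0 : forall X, realizes X zero_edit X }.

Definition zero_arm (Edit Write : Type) (El : edit_language Edit Write)
  (X : Write) : Edit * Write := (zero_edit El, X).

(* Any finite class of admissible arms, not necessarily all of them; it is
   deterministic, hence fixed before any loss is observed. *)
Record arm_class (Edit Write : choiceType) (El : edit_language Edit Write)
    (K : nat) (X : Write) := ArmClass {
  arms :> {fset Edit * Write};
  zero_arm_in : zero_arm El X \in arms;
  arms_realize : forall a, a \in arms -> realizes El X a.1 a.2;
  arms_budget : forall a, a \in arms -> (edited_factors El a.1 <= K)%N }.

Definition arm_cmr (R : realType) (State : Type) (Edit Write : choiceType)
    (dQ dW : measure_display)
    (Task : measurableType dQ) (Rollout : measurableType dW)
    (g : memory_mechanism State Write)
    (L : operational_loss R State Task Rollout)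
    (D : evaluation_protocol R Task Rollout)
    (a : Edit * Write) (X : Write) : R :=
  cmr g L D a.2 X.

(* The default value of the iterated maximum is the value at the zero-edit arm,
   which belongs to the class, so this is the maximum of f over the class. *)
Definition max_arms (R : realType) (Edit Write : choiceType)
    (El : edit_language Edit Write) (K : nat) (X : Write)
    (A : arm_class El K X) (f : Edit * Write -> R) : R :=
  \big[Num.max/f (zero_arm El X)]_(a <- arms A) f a.

Definition arm_value (R : realType) (State : Type) (Edit Write : choiceType)
    (dQ dW : measure_display)
    (Task : measurableType dQ) (Rollout : measurableType dW)
    (g : memory_mechanism State Write)
    (L : operational_loss R State Task Rollout)
    (D : evaluation_protocol R Task Rollout)
    (El : edit_language Edit Write) (K : nat) (X : Write)
    (A : arm_class El K X) : R :=
  max_arms A (fun a => arm_cmr g L D a X).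

(* The sigma-algebra generated by the observations obs 0, ..., obs t. *)
Definition history (T : Type) (dO : measure_display)
    (Obs : measurableType dO) (obs : nat -> T -> Obs) (t : nat) :
    set (set T) :=
  <<s [set C | exists s (B : set Obs),
         [/\ (s <= t)%N, measurable B & C = obs s @^-1` B] ] >>.

(* f is a measurable function of the observations up to time t. *)
Definition computed_at (R : realType) (T : Type) (dO : measure_display)
    (Obs : measurableType dO) (obs : nat -> T -> Obs) (t : nat)
    (f : T -> R) : Prop :=
  forall B : set R, measurable B -> history obs t (f @^-1` B).

Definition confidence_event (R : realType) (T : Type)
    (State : Type) (Edit Write : choiceType) (dQ dW : measure_display)
    (Task : measurableType dQ) (Rollout : measurableType dW)
    (g : memory_mechanism State Write)
    (L : operational_loss R State Task Rollout)
    (D : evaluation_protocol R Task Rollout)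
    (El : edit_language Edit Write) (K : nat) (X : Write)
    (A : arm_class El K X) (LCB UCB : nat -> Edit * Write -> T -> R) :
    set T :=
  [set w | forall a, a \in arms A -> forall t,
     LCB t a w <= arm_cmr g L D a X <= UCB t a w].

(* Main.v *)
Require Import Defs.
From HB Require Import structures.
From mathcomp Require Import all_boot all_order all_algebra finmap.
From mathcomp Require Import all_classical all_reals all_analysis.

Set Implicit Arguments.
Unset Strict Implicit.
Unset Printing Implicit Defensive.
Import Order.TTheory GRing.Theory Num.Theory.
Local Open Scope classical_set_scope.
Local Open Scope ring_scope.

(** Fix an outcome in the confidence event and a time t. The upper bounds dominate the regrets on
    the whole class, so by monotonicity of the maximum ([le_max_arms]) the largest [UCB] dominates
    the value; the lower bound at the reported arm lies below its regret. Hence value minus regret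
    of the reported arm is at most the gap between these two bounds, which is at most [eta].
    Validity at all arms at once is what permits a data-dependent [ahat]. *)

Lemma le_max_arms (R : realType) (Edit Write : choiceType)
    (El : edit_language Edit Write) (K : nat) (X : Write)
    (A : arm_class El K X) (f h : Edit * Write -> R) :
  (forall a, a \in arms A -> f a <= h a) -> max_arms A f <= max_arms A h.
Proof.
(* [big_seq] records membership in the class, where alone [f] and [h] are compared. *)
move=> le_fh; rewrite /max_arms big_seq [leRHS]big_seq.
elim/big_ind2: _ => [|x1 x2 y1 y2 le1 le2|a aA].
(* The default values are those at the zero-edit arm, itself a member of the class. *)
- exact/le_fh/zero_arm_in.
- by rewrite ge_max !le_max le1 le2 orbT.
- exact: le_fh.
Qed.

Theorem proposition1 (R : realType)
    (State : Type) (Edit Write : choiceType)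
    (dQ dW : measure_display)
    (Task : measurableType dQ) (Rollout : measurableType dW)
    (g : memory_mechanism State Write)
    (L : operational_loss R State Task Rollout)
    (D : evaluation_protocol R Task Rollout)
    (El : edit_language Edit Write) (K : nat) (X : Write)
    (A : arm_class El K X)
    (dT dO : measure_display) (T : measurableType dT)
    (P : probability T R)
    (Obs : measurableType dO) (obs : nat -> T -> Obs)
    (obs_meas : forall s, measurable_fun setT (obs s))
    (LCB UCB : nat -> Edit * Write -> T -> R)
    (LCB_hist : forall t a, a \in arms A -> computed_at obs t (LCB t a))
    (UCB_hist : forall t a, a \in arms A -> computed_at obs t (UCB t a))
    (delta : R) (delta_itv : 0 < delta < 1)
    (coverage :
      ((1 - delta)%:E <= P (confidence_event g L D A LCB UCB))%E)
    (eta : R) (eta_ge0 : 0 <= eta)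
    (ahat : nat -> T -> Edit * Write) :
  forall w : T, confidence_event g L D A LCB UCB w ->
  forall t : nat,
    ahat t w \in arms A ->
    max_arms A (fun a => UCB t a w) - LCB t (ahat t w) w <= eta ->
    arm_cmr g L D (ahat t w) X >= arm_value g L D A - eta.
Proof.
move=> w Ew t ahatA gap.
have le_value : arm_value g L D A <= max_arms A (fun a => UCB t a w).
  by apply: le_max_arms => a /Ew /(_ t) /andP[].
have /andP[le_lcb _] := Ew _ ahatA t.
(* It remains to bound the largest [UCB] minus the regret of the reported arm; replacing that regret
   by its [LCB] only enlarges the difference. *)
rewrite lerBlDr (le_trans le_value)// -lerBlDl.
by rewrite (le_trans _ gap)// lerB.
Qed.
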